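(* Let $\{B_i : i\in\mathbb{N}\}$ be a family of infinite subsets of $\mathbb{N}$. Suppose there is $n\in\mathbb{N}$ such that $|B_i\cap B_j|\leq n$ for all $i\neq j$. If $n>0$, suppose furthermore that $\{i\in\mathbb{N}: F\subseteq B_i\}$ is finite for every $F\subseteq\mathbb{N}$ of size $n$. Let $$S=\bigcup_{i\in\mathbb{N}}S_\infty(B_i)\ \cup\ \bigcup_{i,j\in\mathbb{N}}\bigcup_{k=0}^{n}I_k(B_i,B_j).$$ Then $S$, with composition and the subspace topology from $I(\mathbb{N})$, is a Polish inverse semigroup with the Pettis property.
   Context: $\mathbb{N}$ denotes the non-negative integers. $I(\mathbb{N})$ is the set of all bijections $f:A\to B$ with $A,B\subseteq\mathbb{N}$ (including the empty function $1_\emptyset$); write $\mathrm{dom}(f)=A$, $\mathrm{im}(f)=B$. The operation is composition of partial functions: $\mathrm{dom}(f\circ g)=g^{-1}(\mathrm{dom}(f)\cap\mathrm{im}(g))$ and $(f\circ g)(x)=f(g(x))$. It is an inverse semigroup, the inverse of $f$ being the inverse function $f^{-1}:B\to A$. The topology $\tau_{pp}$ on $I(\mathbb{N})$ is generated (as a subbase) by the sets $v(x,y)=\{f: x\in\mathrm{dom}(f),\ f(x)=y\}$, $w_1(x)=\{f: x\notin\mathrm{dom}(f)\}$, $w_2(y)=\{f: y\notin\mathrm{im}(f)\}$ for $x,y\in\mathbb{N}$; with it, $I(\mathbb{N})$ is a Polish topological inverse semigroup (composition and inversion are continuous). $I(\mathbb{N})$ always carries $\tau_{pp}$. For $B\subseteq\mathbb{N}$,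 $S_\infty(B)$ is the group of all bijections from $B$ to $B$, viewed as a subset of $I(\mathbb{N})$. For $k\in\mathbb{N}$ and $A,B\subseteq\mathbb{N}$, $I_k(A,B)=\{f\in I(\mathbb{N}): \mathrm{dom}(f)\subseteq A,\ \mathrm{im}(f)\subseteq B,\ |\mathrm{dom}(f)|=k\}$; in particular $I_0(A,B)=\{1_\emptyset\}$. A subset $A$ of a topological space has the Baire property if there is an open set $V$ such that $A\triangle V$ is meager. A topological inverse semigroup $S$ has the Pettis property if for every non-meager $A\subseteq S$ with the Baire property there are an idempotent $e\in S$ and an open set $V\subseteq S$ such that $e\in V$ and $V\subseteq A^{-1}A$, where $A^{-1}A=\{a^{-1}b: a,b\in A\}$ and $a^{-1}$ is the (unique) inverse of $a$ in $S$. *)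

(* Defs.v *)
From HB Require Import structures.
From mathcomp Require Import all_boot all_order all_algebra.
From mathcomp Require Import all_classical all_reals all_analysis.

Set Implicit Arguments.
Unset Strict Implicit.
Unset Printing Implicit Defensive.

Import Order.TTheory GRing.Theory Num.Theory.
Local Open Scope classical_set_scope.
Local Open Scope ring_scope.

(** * General topology *)

Definition nowhere_dense (T : topologicalType) (A : set T) : Prop :=
  interior (closure A) = set0.

Definition meager (T : topologicalType) (A : set T) : Prop :=
  exists F : nat -> set T,
    (forall i, nowhere_dense (F i)) /\ A = \bigcup_i F i.

(* [`+`] is the symmetric difference. *)
Definition Baire_property (T : topologicalType) (A : set T) : Prop :=
  exists V : set T, open V /\ meager (A `+` V).

Definition separable (T : topologicalType) : Prop :=
  exists D : set T, countable D /\ dense D.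

Definition completely_metrizable (R : realType) (T : topologicalType) : Prop :=
  exists d : T -> T -> R,
    [/\ forall x y, d x y = 0 <-> x = y,
        forall x y, d x y = d y x,
        forall x y z, d x z <= d x y + d y z,
        forall x : T, nbhs x =
          filter_from [set e : R | 0 < e] (fun e => [set y | d x y < e]) &
        forall u : nat -> T,
          (forall e : R, 0 < e -> exists N : nat, forall m k : nat,
             (N <= m)%N -> (N <= k)%N -> d (u m) (u k) < e) ->
          exists l : T, u @ \oo --> l].

Definition Polish (R : realType) (T : topologicalType) : Prop :=
  separable T /\ completely_metrizable R T.

(** * Topological inverse semigroups *)

(* [b] is an inverse of [a] when [a b a = a] and [b a b = b]; the equivalence
   says that [inv a] is the unique inverse of [a]. *)
Definition inverse_semigroup (T : Type) (mul : T -> T -> T) (inv : T -> T) :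
    Prop :=
  associative mul /\
  forall a b, (mul (mul a b) a = a /\ mul (mul b a) b = b) <-> b = inv a.

Definition topological_inverse_semigroup (T : topologicalType)
    (mul : T -> T -> T) (inv : T -> T) : Prop :=
  [/\ inverse_semigroup mul inv,
      continuous (fun p : T * T => mul p.1 p.2) & continuous inv].

Definition Polish_inverse_semigroup (R : realType) (T : topologicalType)
    (mul : T -> T -> T) (inv : T -> T) : Prop :=
  topological_inverse_semigroup mul inv /\ Polish R T.

Definition Pettis_property (T : topologicalType)
    (mul : T -> T -> T) (inv : T -> T) : Prop :=
  forall A : set T, ~ meager A -> Baire_property A ->
    exists (e : T) (V : set T),
      [/\ mul e e = e, open V, V e &
          V `<=` [set c | exists a b, [/\ A a, A b & c = mul (inv a) b]]].

(** * The symmetric inverse monoid on the natural numbers *)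

(* A bijection between two sets of natural numbers is encoded as an injective
   partial function; [None] marks the points outside the domain. *)
Record pbij := PBij {
  pbij_fun :> nat -> option nat;
  pbij_inj : forall x y z, pbij_fun x = Some z -> pbij_fun y = Some z -> x = y
}.

Definition pbij_dom (f : pbij) : set nat := [set x | exists y, f x = Some y].

Definition pbij_im (f : pbij) : set nat := [set y | exists x, f x = Some y].

Lemma pbij_comp_inj (f g : pbij) x y z :
  obind f (g x) = Some z -> obind f (g y) = Some z -> x = y.
Proof.
case gx: (g x) => [u|//]; case gy: (g y) => [v|//] /= fu fv.
by apply: (pbij_inj gx); rewrite gy (pbij_inj fu fv).
Qed.

(* [pbij_comp f g] is f o g: [g] is applied first. *)
Definition pbij_comp (f g : pbij) : pbij :=
  PBij (pbij_fun := fun x => obind f (g x)) (@pbij_comp_inj f g).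

Definition pp_v (x y : nat) : set pbij := [set f | f x = Some y].

Definition pp_w1 (x : nat) : set pbij := [set f | ~ pbij_dom f x].

Definition pp_w2 (y : nat) : set pbij := [set f | ~ pbij_im f y].

Definition pp_subbase : set (set pbij) :=
  [set U | [\/ exists x y, U = pp_v x y,
               exists x, U = pp_w1 x |
               exists y, U = pp_w2 y]].

HB.instance Definition _ := gen_eqMixin pbij.
HB.instance Definition _ := gen_choiceMixin pbij.
HB.instance Definition _ :=
  isSubBaseTopological.Build pbij pp_subbase (fun U : set pbij => U).

(* S_infty(B) *)
Definition Sym_on (B : set nat) : set pbij :=
  [set f | pbij_dom f = B /\ pbij_im f = B].

(* I_k(A, B) *)
Definition I_rank (k : nat) (A B : set nat) : set pbij :=
  [set f | [/\ pbij_dom f `<=` A, pbij_im f `<=` B & (pbij_dom f #= `I_k)%card]].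

(* Main.v *)
(* The code f |-> (k |-> (f k, f^-1 k)) identifies I(N) with a closed subset of
   a countable power of a countable discrete space.  A set with more than n
   elements lies in at most one B_i, so limits of elements of S stay in S: S is
   closed in I(N), hence Polish, and each S_infty(B_i) is open in S.  If n > 0,
   an element of rank n is isolated in S, because its domain lies in only
   finitely many B_i.  The remaining elements of finite rank are countably many
   and not isolated (add a far away pair to f; when n = 0, the identities of the
   B_i accumulate at the empty function), so they form a meager set.  Hence a
   non-meager A contains an isolated element a, and a^-1 a is isolated, or A is
   non-meager in some S_infty(B_i), where Pettis' theorem for Polish groups
   applies. *)
Require Import Defs.
From mathcomp Require Import finmap all_boot all_order all_algebra.
From mathcomp Require Import all_classical all_reals all_analysis.
Import Order.TTheory GRing.Theory Num.Theory.
Local Open Scope classical_set_scope.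
Local Open Scope card_scope.
Set Implicit Arguments.
Unset Strict Implicit.
Unset Printing Implicit Defensive.

(** * Baire category and coded Polish spaces *)

Definition cylinder (T K : Type) (c : T -> nat -> K) (x : T) (N : nat) :
    set T :=
  [set y | forall k, (k < N)%N -> c x k = c y k].

(* [c] identifies [T] with a closed subspace of the product space K^N, where K
   is discrete. *)
Definition closed_coding (T : topologicalType) (K : Type)
    (c : T -> nat -> K) : Prop :=
  [/\ forall x y, (forall k, c x k = c y k) -> x = y,
      forall x, nbhs x = filter_from setT (cylinder c x) &
      forall w : nat -> K,
        (forall N, exists x, forall k, (k < N)%N -> c x k = w k) ->
        exists x, forall k, c x k = w k].

Section ClosedCoding.
Context (T : topologicalType) (K : countType) (c : T -> nat -> K).
Context (cP : closed_coding c).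

Lemma cylinder_le x M N : (M <= N)%N -> cylinder c x N `<=` cylinder c x M.
Proof. by move=> MN y xy k kM; apply: xy; apply: leq_trans MN. Qed.

Lemma cylinder_trans x y N M :
  (N <= M)%N -> cylinder c x N y -> cylinder c y M `<=` cylinder c x N.
Proof. by move=> NM xy z yz k kN; rewrite xy// yz// (leq_trans kN). Qed.

Lemma nbhs_cylinder x N : nbhs x (cylinder c x N).
Proof. by case: cP => _ -> _; exists N. Qed.

Lemma nbhs_codingP x (A : set T) :
  nbhs x A <-> exists N, cylinder c x N `<=` A.
Proof.
case: cP => _ -> _; split=> [[N _ NA]|[N NA]]; first by exists N.
by exists N.
Qed.

Lemma open_codingP (A : set T) :
  open A <-> forall x, A x -> exists N, cylinder c x N `<=` A.
Proof.
rewrite openE; split=> [oA x /oA/nbhs_codingP//|oA x Ax].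
by apply/nbhs_codingP/oA.
Qed.

Lemma open_cylinder x N : open (cylinder c x N).
Proof. by apply/open_codingP => y xy; exists N; apply: cylinder_trans. Qed.

Local Open Scope ring_scope.

Lemma coding_separable (x0 : T) : separable T.
Proof.
pose code (x : T) N := [seq c x k | k <- iota 0 N].
have code_cyl x y N : code x N = code y N -> cylinder c x N y.
  move=> xy k kN; have := congr1 (fun s => nth (c x k) s k) xy.
  by rewrite !(nth_map 0%N) ?size_iota// nth_iota.
(* One representative is chosen for each finite prefix that occurs; the filler [x0] serves the
   numbers that code no prefix. *)
pose pickN n : T :=
  if pselect (exists x, exists N, pickle (code x N) = n) is left h
  then sval (cid h) else x0.
exists (range pickN); split; first exact: card_image_le.
move=> O [x Ox] /open_codingP /(_ x Ox)[N NO].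
exists (pickN (pickle (code x N))); split; last by exists (pickle (code x N)).
apply: NO; rewrite /pickN; case: pselect => [h|[]]; last by exists x, N.
case: cid => y /= [M /(pcan_inj pickleK) yx]; apply: code_cyl.
(* Equal codes come from prefixes of equal length, so the representative agrees with [x] on exactly
   [N] coordinates. *)
have /(congr1 size) := yx; rewrite !size_map !size_iota => MN.
by rewrite MN in yx.
Qed.

(** * The ultrametric of a coding *)

Section Distance.
Context (R : realType).

(** The usual ultrametric 1/(k+1), where k is the first coordinate at which the codes differ. *)
Definition coding_dist (x y : T) : R :=
  if pselect (exists k, c x k != c y k) is left h then (ex_minn h).+1%:R^-1
  else 0.

Lemma coding_dist_val x y :
  coding_dist x y = 0 \/ exists N, coding_dist x y = N.+1%:R^-1.
Proof.
by rewrite /coding_dist; case: pselect => [h|_]; [right; eexists|left].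
Qed.

(** If m is the first difference, then 1/(m+1) < 1/(N+1) means N < m, hence agreement on the N+1
    coordinates 0, ..., N. The metric axioms below are reduced to cylinders in this way. *)
Lemma coding_dist_lt x y N :
  coding_dist x y < N.+1%:R^-1 <-> cylinder c x N.+1 y.
Proof.
rewrite /coding_dist; case: pselect => [h|h].
  case: ex_minnP => m mP mmin; rewrite ltf_pV2 ?posrE ?ltr0n// ltr_nat ltnS.
  split=> [Nm k|xy]; last by rewrite ltnNge; apply: contra mP => mN; rewrite xy.
  rewrite ltnS => kN; apply/eqP/negPn/negP => /mmin.
  by rewrite leqNgt (leq_ltn_trans kN).
rewrite invr_gt0 ltr0n; split=> // _ k _.
by apply: contrapT => /eqP xy; apply: h; exists k.
Qed.

Lemma coding_dist_ge0 x y : 0 <= coding_dist x y.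
Proof. by case: (coding_dist_val x y) => [->|[N ->]]. Qed.

Lemma inv_natS_lt (e : R) : 0 < e -> exists N, N.+1%:R^-1 < e.
Proof. by move=> /ltr_add_invr[N]; rewrite add0r; exists N. Qed.

Lemma coding_completely_metrizable : completely_metrizable R T.
Proof.
have [cinj _ ccl] := cP.
exists coding_dist; split=> [x y|x y|x y z|x|u ucauchy].
- split=> [xy0|->].
    apply: cinj => k; have : coding_dist x y < k.+1%:R^-1.
      by rewrite xy0 invr_gt0 ltr0n.
    by move=> /coding_dist_lt; apply.
  rewrite /coding_dist; case: pselect => // h; exfalso.
  by case: h => k; rewrite eqxx.
- have dist_le x' y' : coding_dist x' y' <= coding_dist y' x'.
    have [->|[N dN]] := coding_dist_val x' y'; first exact: coding_dist_ge0.
    rewrite leNgt; apply/negP; rewrite {1}dN => /coding_dist_lt yx.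
    have /coding_dist_lt : cylinder c x' N.+1 y' by move=> k /yx.
    by rewrite dN ltxx.
  by apply/eqP; rewrite eq_le !dist_le.
(* If d(x,z) = 1/(N+1) exceeded the sum, both summands would be below 1/(N+1); then all three codes
   would agree on N+1 coordinates, and d(x,z) would be smaller than itself. *)
- have [->|[N dN]] := coding_dist_val x z.
    by rewrite addr_ge0// coding_dist_ge0.
  rewrite leNgt; apply/negP; rewrite {1}dN => lt_dN.
  have /coding_dist_lt xy : coding_dist x y < N.+1%:R^-1.
    by apply: le_lt_trans lt_dN; rewrite lerDl coding_dist_ge0.
  have /coding_dist_lt yz : coding_dist y z < N.+1%:R^-1.
    by apply: le_lt_trans lt_dN; rewrite lerDr coding_dist_ge0.
  have /coding_dist_lt : cylinder c x N.+1 z by apply: cylinder_trans yz.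
  by rewrite dN ltxx.
- apply/seteqP; split=> A.
    move=> /nbhs_codingP[N NA]; exists N.+1%:R^-1; first by rewrite /= invr_gt0.
    move=> y /= /coding_dist_lt xy; apply: NA.
    exact: cylinder_le xy.
  case=> e /= e0 eA; have [N Ne] := inv_natS_lt e0.
  apply/nbhs_codingP; exists N.+1 => y /coding_dist_lt xy.
  by apply: eA; apply: lt_trans Ne.
(* From index [M N] on, the first [N] coordinates are constant, so coordinate k of the limit is read
   off at index [M k.+1]. *)
- have /choice[M MP] N : exists M, forall m k, (M <= m)%N -> (M <= k)%N ->
      cylinder c (u m) N (u k).
    have N1 : 0 < N.+1%:R^-1 :> R by rewrite invr_gt0.
    have [M MP] := ucauchy _ N1; exists M => m k Mm Mk.
    apply: (@cylinder_le _ _ N.+1) => //.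
    by apply/coding_dist_lt/MP.
  have MN k m : (M k.+1 <= m)%N -> c (u m) k = c (u (M k.+1)) k.
    by move=> km; apply: MP (leqnn _) _ _.
  have [|l lP] := ccl (fun k => c (u (M k.+1)) k).
    move=> N; pose m := (\max_(k < N) M k.+1)%N; exists (u m) => k kN.
    by apply: MN; rewrite /m (bigD1 (Ordinal kN))//= leq_maxl.
  exists l => A /nbhs_codingP[N NA].
  exists (\max_(k < N) M k.+1)%N => // m /= Nm; apply: NA => k kN.
  rewrite lP; apply/esym/MN; apply: leq_trans Nm.
  by rewrite (bigD1 (Ordinal kN))//= leq_maxl.
Qed.

End Distance.

Lemma coding_Polish (R : realType) (x0 : T) : Polish R T.
Proof.
by split; [exact: coding_separable x0|exact: coding_completely_metrizable].
Qed.

End ClosedCoding.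

(** * Meager sets and the Baire category theorem *)

Section Meager.
Context (T : topologicalType).
Implicit Types A B G : set T.

Lemma nowhere_denseP A : nowhere_dense A <->
  forall O, open O -> O !=set0 ->
    exists O', [/\ open O', O' !=set0, O' `<=` O & O' `&` A = set0].
Proof.
split=> [A0 O oO [x Ox]|AP].
  have [y [Oy nAy]] : exists y, O y /\ ~ closure A y.
    apply: contrapT => /forallNP OA.
    suff : interior (closure A) x by rewrite A0.
    rewrite /interior/= nbhsE; exists O => // y Oy.
    by apply: contrapT => nAy; apply: (OA y); split.
  exists (O `&` ~` closure A); split.
  - by apply: openI => //; apply: closed_openC; apply: closed_closure.
  - by exists y.
  - by move=> z [].
  - by rewrite -subset0 => z [[_ nAz] /subset_closure].
rewrite /nowhere_dense -subset0 => x Ax.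
have [|O' [oO' [y O'y] O'A O'A0]] := AP _ (open_interior (closure A)).
  by exists x.
have /interior_subset/(_ O')[|z []] := O'A _ O'y.
  exact: open_nbhs_nbhs.
by move=> Az O'z; suff: set0 z by []; rewrite -O'A0; split.
Qed.

Lemma nowhere_dense_sub A B : A `<=` B -> nowhere_dense B -> nowhere_dense A.
Proof.
rewrite /nowhere_dense => /closureS/interiorS AB B0.
by rewrite -subset0 -B0.
Qed.

Lemma meager_sub A B : A `<=` B -> meager B -> meager A.
Proof.
move=> AB [F [nF BE]]; exists (fun i => A `&` F i); split=> [i|].
  by apply: nowhere_dense_sub (nF i) => x [].
by rewrite -setI_bigcupr -BE; apply/esym/setIidPl.
Qed.

Lemma nowhere_dense_meager A : nowhere_dense A -> meager A.
Proof.
by move=> A0; exists (fun=> A); split=> //; rewrite bigcup_const//; exists 0%N.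
Qed.

Lemma meager_bigcup (A : nat -> set T) :
  (forall i, meager (A i)) -> meager (\bigcup_i A i).
Proof.
move=> /choice[F FP].
exists (fun k => if unpickle k is Some p then F p.1 p.2 else set0).
split=> [k|].
  case: unpickle => [p|]; first by have [] := FP p.1.
  by rewrite /nowhere_dense closure0 interior0.
apply/seteqP; split=> x [i _].
  have [_ ->] := FP i => -[j _ Fx]; exists (pickle (i, j)) => //.
  by rewrite pickleK.
case: unpickle => [p|]//= Fx; exists p.1 => //.
by have [_ ->] := FP p.1; exists p.2.
Qed.

Lemma meagerU A B : meager A -> meager B -> meager (A `|` B).
Proof.
move=> mA mB; rewrite -bigcup2E; apply: meager_bigcup => -[|[|i]]//=.
by apply: nowhere_dense_meager; rewrite /nowhere_dense closure0 interior0.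
Qed.

(** On the open set [G], [phi] and [psi] are mutually inverse homeomorphisms, so a nonempty open
    part of [G] can be moved by [phi], shrunk off [F i], and moved back. Translations of S are
    invertible only on such a piece, whence the restriction to [G]. *)
Lemma meager_preimage G (phi psi : T -> T) A :
  open G -> continuous phi -> continuous psi ->
  (forall x, G x -> G (phi x) /\ psi (phi x) = x) ->
  (forall x, G x -> G (psi x) /\ phi (psi x) = x) ->
  meager A -> meager (G `&` phi @^-1` A).
Proof.
move=> oG cphi cpsi phiG psiG [F [nF ->]].
exists (fun i => G `&` phi @^-1` F i); split=> [i|]; last first.
  by rewrite preimage_bigcup setI_bigcupr.
have oI (f : T -> T) O : continuous f -> open O -> open (f @^-1` O).
  by move=> /continuousP; apply.
apply/nowhere_denseP => O oO O0.
have [[x [Ox Gx]]|OG0] := pselect (O `&` G !=set0); last first.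
  exists O; split=> //; rewrite -subset0 => y [Oy [Gy _]].
  by apply: OG0; exists y.
have /nowhere_denseP/(_ (G `&` psi @^-1` O)) := nF i.
move=> [||O' [oO' [y O'y] O'G O'F]].
- by apply: openI => //; apply: oI.
- have [Gx' xK] := phiG _ Gx; exists (phi x); split=> //.
  by rewrite /preimage/= xK.
have [Gy Oy] := O'G _ O'y; have [Gy' yK] := psiG _ Gy.
exists (O `&` phi @^-1` O'); split.
- by apply: openI => //; apply: oI.
- by exists (psi y); split=> //; rewrite /preimage/= yK.
- by move=> z [].
- rewrite -subset0 => z [[_ O'z] [_ Fz]].
  by suff: set0 (phi z) by []; rewrite -O'F.
Qed.

End Meager.

(** Nested cylinders of strictly increasing length are chosen inside [U], each avoiding one more
    [F i]; the completeness clause of the coding supplies a point common to all of them. *)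
Lemma coding_Baire (T : topologicalType) (K : countType) (c : T -> nat -> K)
    (U A : set T) : closed_coding c -> open U -> U !=set0 -> meager A ->
  exists2 x, U x & ~ A x.
Proof.
move=> cP oU [x0 Ux0] [F [nF ->]]; have [_ _ ccl] := cP.
have /(open_codingP cP)/(_ _ Ux0)[N0 N0U] := oU.
(* A state (i, (x, N)) stands for stage i with the cylinder of length N around x; the cylinder of
   [q] lies in that of [p] and misses [F p.1]. *)
pose R (p q : nat * (T * nat)) := [/\ q.1 = p.1.+1, (p.2.2 < q.2.2)%N,
  cylinder c p.2.1 p.2.2 q.2.1 & cylinder c q.2.1 q.2.2 `&` F p.1 = set0].
have step p : {q | R p q}.
  apply: cid; case: p => i [x N].
  have /nowhere_denseP/(_ (cylinder c x N))[||O [oO [y Oy] OxN OF]] := nF i.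
  - exact: open_cylinder cP _ _.
  - by exists x.
  have /(open_codingP cP)/(_ _ Oy)[M MO] := oO.
  (* [N.+1] makes the new cylinder strictly longer, and [M] keeps it inside [O]. *)
  exists (i.+1, (y, maxn N.+1 M)); split=> //=.
  - by rewrite leq_max leqnn.
  - exact: OxN.
  - rewrite -subset0 => z [yz Fz]; rewrite -OF; split=> //; apply: MO.
    by apply: cylinder_le yz; rewrite leq_max leqnn orbT.
have [f [f0 fS]] := dependent_choice step (0%N, (x0, N0)).
have f1 i : (f i).1 = i.
  by elim: i => [|i IH]; rewrite ?f0//; case: (fS i); rewrite IH.
have fN i : (i <= (f i).2.2)%N.
  by elim: i => // i IH; apply: leq_ltn_trans IH _; case: (fS i).
have fcyl i j : (i <= j)%N ->
    ((f i).2.2 <= (f j).2.2)%N /\ cylinder c (f i).2.1 (f i).2.2 (f j).2.1.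
  elim: j => [|j IH]; first by rewrite leqn0 => /eqP->.
  rewrite leq_eqVlt => /orP[/eqP<-//|]; rewrite ltnS => /IH[Nij xij].
  have [_ Nj xj _] := fS j; split; first exact: leq_trans (ltnW Nj).
  exact: cylinder_trans xj.
(* The cylinder of stage k+1 has length at least k+1, so coordinate k is fixed from that stage
   on. *)
have [|x xP] := ccl (fun k => c (f k.+1).2.1 k).
  move=> N; exists (f N).2.1 => k kN; apply/esym; have [_] := fcyl _ _ kN.
  by apply; apply: fN.
have xcyl i : cylinder c (f i).2.1 (f i).2.2 x.
  move=> k ki; rewrite xP; have [ik|ki1] := leqP i k.+1.
    by have [_] := fcyl _ _ ik; apply.
  have [_] := fcyl _ _ (ltnW ki1); move=> /(_ k) -> //; exact: fN.
exists x; first by have := xcyl 0%N; rewrite f0 => /N0U.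
move=> [i _ Fx]; have [_ _ _] := fS i; rewrite f1 -subset0 => /(_ x); apply.
by split=> //; apply: xcyl.
Qed.

(** * Topology of I(N) *)

Lemma pbij_ext (f g : pbij) : (forall x, f x = g x) -> f = g.
Proof.
case: f g => [f fi] [g gi] /= /funext fg; case: _ / fg in gi *.
by rewrite (Prop_irrelevance fi gi).
Qed.

Definition pbij_inv_fun (f : pbij) (y : nat) : option nat :=
  if pselect (exists x, f x = Some y) is left h then Some (sval (cid h))
  else None.

Lemma pbij_inv_funP (f : pbij) x y : pbij_inv_fun f y = Some x <-> f x = Some y.
Proof.
rewrite /pbij_inv_fun; case: pselect => [h|h]; last first.
  by split=> // fx; case: h; exists x.
case: cid => z /= fz; split=> [[<-]//|fx].
by rewrite (pbij_inj fz fx).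
Qed.

Lemma pbij_inv_inj (f : pbij) x y z :
  pbij_inv_fun f x = Some z -> pbij_inv_fun f y = Some z -> x = y.
Proof. by move=> /pbij_inv_funP fx /pbij_inv_funP; rewrite fx => -[]. Qed.

Definition pbij_inv (f : pbij) : pbij :=
  PBij (pbij_fun := pbij_inv_fun f) (@pbij_inv_inj f).

Lemma pbij_invP (f : pbij) x y : pbij_inv f y = Some x <-> f x = Some y.
Proof. exact: pbij_inv_funP. Qed.

(** Reduces equality of partial maps to equality of their graphs, where [pbij_invP] applies. *)
Lemma option_eqP (T : Type) (a b : option T) :
  (forall z, a = Some z <-> b = Some z) -> a = b.
Proof.
case: a b => [a|] [b|] ab //; first by have /ab : Some b = Some b by [].
  by have /ab : Some a = Some a by [].
by have /ab : Some b = Some b by [].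
Qed.

Lemma pbij_invK : involutive pbij_inv.
Proof.
move=> f; apply: pbij_ext => x; apply: option_eqP => y.
by split=> [/pbij_invP/pbij_invP//|fx]; apply/pbij_invP/pbij_invP.
Qed.

Lemma pbij_inv_comp f g :
  pbij_inv (pbij_comp f g) = pbij_comp (pbij_inv g) (pbij_inv f).
Proof.
apply: pbij_ext => y; apply: option_eqP => x.
split=> [/pbij_invP/=|].
  case gx: (g x) => [u|//] /= fu.
  by move/pbij_invP: fu => /= ->/=; apply/pbij_invP.
rewrite /=; case fy: (pbij_inv_fun f y) => [u|//] /= gx.
move/pbij_invP: fy => fy; move/pbij_invP: gx => gx.
by apply/pbij_invP; rewrite /= gx.
Qed.

Lemma pbij_compA : associative pbij_comp.
Proof. by move=> f g h; apply: pbij_ext => x /=; case: (h x). Qed.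

Lemma pbij_compK f : pbij_comp (pbij_comp f (pbij_inv f)) f = f.
Proof.
apply: pbij_ext => x /=; case fx: (f x) => [y|//] /=.
by move/pbij_invP: (fx) => /= ->.
Qed.

Lemma pbij_inverse_unique f g :
  pbij_comp (pbij_comp f g) f = f -> pbij_comp (pbij_comp g f) g = g ->
  g = pbij_inv f.
Proof.
(* From a b a = a, b is defined at y and a sends b(y) to y = a(x); injectivity of a gives b(y) = x.
   Exchanging the two maps gives the converse inclusion of graphs. *)
have aux a b x y : pbij_comp (pbij_comp a b) a = a -> a x = Some y ->
    b y = Some x.
  move=> /(congr1 (fun h : pbij => h x))/= aba ax; move: aba.
  rewrite ax /=; case: (b y) => [u|//] /= au.
  by rewrite (pbij_inj au ax).
move=> fgf gfg; apply: pbij_ext => y; apply: option_eqP => x.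
split=> [gy|/pbij_invP fx]; last exact: (aux f g).
by apply/pbij_invP; apply: (aux g f).
Qed.

Lemma pbij_inverseP f g :
  (pbij_comp (pbij_comp f g) f = f /\ pbij_comp (pbij_comp g f) g = g) <->
  g = pbij_inv f.
Proof.
split=> [[]|->]; first exact: pbij_inverse_unique.
by split; [|rewrite -{2}(pbij_invK f)]; apply: pbij_compK.
Qed.

Lemma pbij_dom_inv f : pbij_dom (pbij_inv f) = pbij_im f.
Proof. by apply/seteqP; split=> y [x /pbij_invP]; exists x. Qed.

Lemma pbij_im_inv f : pbij_im (pbij_inv f) = pbij_dom f.
Proof. by rewrite -pbij_dom_inv pbij_invK. Qed.

(** The inverse is recorded too, since finitely many values of f cannot decide whether y lies
    outside the image, as membership in [pp_w2 y] requires. *)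
Definition pbij_code (f : pbij) (k : nat) : option nat * option nat :=
  (f k, pbij_inv f k).

Lemma subbase_open (U : set pbij) : pp_subbase U -> open U.
Proof.
move=> sU; exists [set U]; last by rewrite bigcup_set1.
by move=> _ ->; apply: (@finI_from1 _ _ _ id).
Qed.

(** Each component of each coordinate is fixed by one subbasic set: [pp_v] where it is defined,
    [pp_w1] or [pp_w2] where it is [None]. *)
Lemma nbhs_pbij_cylinder (f : pbij) N : nbhs f (cylinder pbij_code f N).
Proof.
elim: N => [|N IH]; first by apply: filterS filterT => g _ k.
have fN : nbhs f [set g : pbij | f N = g N].
  case fN: (f N) => [y|].
    apply: (@filterS _ _ _ (pp_v N y)) => [g <-//|].
    apply: open_nbhs_nbhs; split=> //; apply: subbase_open.
    by constructor 1; exists N, y.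
  apply: (@filterS _ _ _ (pp_w1 N)) => [g /= gN|].
    by case E: (g N) => [y|//]; case: gN; exists y.
  apply: open_nbhs_nbhs; split; last by move=> [y]; rewrite fN.
  by apply: subbase_open; constructor 2; exists N.
have invfN : nbhs f [set g : pbij | pbij_inv f N = pbij_inv g N].
  case fN': (pbij_inv f N) => [x|].
    apply: (@filterS _ _ _ (pp_v x N)) => [g /pbij_invP gN//=|].
    apply: open_nbhs_nbhs; split; last exact/pbij_invP.
    by apply: subbase_open; constructor 1; exists x, N.
  apply: (@filterS _ _ _ (pp_w2 N)) => [g /= gN|].
    case E: (pbij_inv g N) => [x|]; last exact/esym.
    by case: gN; exists x; apply/pbij_invP.
  apply: open_nbhs_nbhs; split; last by move=> [x] /pbij_invP; rewrite fN'.
  by apply: subbase_open; constructor 3; exists N.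
apply: filterS (filterI IH (filterI fN invfN)) => g [fg [/= gN gN']] k.
rewrite ltnS leq_eqVlt => /orP[/eqP->|/fg//].
by rewrite /pbij_code/= gN gN'.
Qed.

Lemma subbase_cylinder (f : pbij) U : pp_subbase U -> U f ->
  exists N, cylinder pbij_code f N `<=` U.
Proof.
move=> [[x [y ->]] fx|[x ->] fx|[y ->] fy].
- by exists x.+1 => g /(_ x (leqnn _))[]; rewrite /pp_v /= fx.
- exists x.+1 => g /(_ x (leqnn _))[fg _] [z gx]; apply: fx; exists z.
  by rewrite fg.
- exists y.+1 => g /(_ y (leqnn _))[_ fg] [z /pbij_invP gz]; apply: fy.
  by exists z; apply/pbij_invP; rewrite /= fg.
Qed.

Lemma nbhs_pbijP (f : pbij) A :
  nbhs f A <-> exists N, cylinder pbij_code f N `<=` A.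
Proof.
split=> [|[N NA]]; last exact: filterS NA (nbhs_pbij_cylinder f N).
rewrite nbhsE => -[V [[D DfinI <-] [X DX fX]] VA].
have [Y YS XE] := DfinI _ DX.
(* As the cylinders around [f] generate a filter, it suffices to treat the members of a finite
   intersection of subbasic sets separately. *)
have cylF : Filter (filter_from setT (cylinder pbij_code f)).
  apply: filter_from_filter; first by exists 0%N.
  move=> M N _ _; exists (maxn M N) => // g fg.
  by split; apply: cylinder_le fg; rewrite leq_max leqnn ?orbT.
have [N _ NX] : filter_from setT (cylinder pbij_code f) X.
  rewrite -XE; apply: filter_bigI => U YU; have /set_mem sU := YS _ YU.
  have Uf : U f by move: fX; rewrite -XE; apply.
  by have [N NU] := subbase_cylinder sU Uf; exists N.
by exists N => g /NX Xg; apply: VA; exists X.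
Qed.

Lemma comp_cylinder f g N : exists M, forall f' g',
  cylinder pbij_code f M f' -> cylinder pbij_code g M g' ->
  cylinder pbij_code (pbij_comp f g) N (pbij_comp f' g').
Proof.
(* At k the composite consults f at g(k), and its inverse consults the inverse of g at the preimage
   of k under f. [M] exceeds all these intermediate points for k < N; the default 0 for an undefined
   one is harmless. *)
pose b k := maxn (odflt 0 (g k)) (odflt 0 (pbij_inv f k)).
pose M := maxn N (\max_(k < N) b k).+1.
have bM k : (k < N)%N -> (b k < M)%N.
  move=> kN; rewrite leq_max [X in _ || X]ltnS.
  by rewrite (bigD1 (Ordinal kN))//= leq_maxl orbT.
have aux (f1 g1 f2 g2 : pbij) k : (forall k, (k < M)%N -> f1 k = f2 k) ->
    g1 k = g2 k -> (odflt 0 (g1 k) < M)%N ->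
    pbij_comp f1 g1 k = pbij_comp f2 g2 k.
  by move=> f12 /= <-; case: (g1 k) => //= u /f12.
exists M => f' g' ff' gg' k kN; rewrite /pbij_code !pbij_inv_comp.
have kM : (k < M)%N by rewrite leq_max kN.
have [fk fk'] := ff' _ kM; have [gk gk'] := gg' _ kM.
congr (_, _); apply: aux => //.
- by move=> j /ff'[].
- by apply: leq_ltn_trans (bM _ kN); rewrite leq_maxl.
- by move=> j /gg'[].
- by apply: leq_ltn_trans (bM _ kN); rewrite leq_maxr.
Qed.

Lemma inv_cylinder f f' N : cylinder pbij_code f N f' ->
  cylinder pbij_code (pbij_inv f) N (pbij_inv f').
Proof.
by move=> ff' k /ff'[fk fk']; rewrite /pbij_code !pbij_invK/= fk fk'.
Qed.

(** That the two components of [w] are mutually inverse partial maps is a condition on two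
    coordinates at a time, so it passes from finite prefixes to [w]. *)
Lemma pbij_code_complete (w : nat -> option nat * option nat) :
  (forall N, exists f, forall k, (k < N)%N -> pbij_code f k = w k) ->
  exists f, forall k, pbij_code f k = w k.
Proof.
move=> wP.
have w12 x y : (w x).1 = Some y <-> (w y).2 = Some x.
  have [f fw] := wP (maxn x y).+1.
  rewrite -!fw ?ltnS ?leq_max ?leqnn ?orbT//.
  by split=> /pbij_invP.
have linj x y z : (w x).1 = Some z -> (w y).1 = Some z -> x = y.
  by move=> /w12 + /w12 => -> [].
exists (PBij linj) => k; rewrite [RHS]surjective_pairing; congr (_, _).
apply: option_eqP => x; split=> [/pbij_invP|] /w12//.
by move=> ?; apply/pbij_invP.
Qed.

(** * Codings of closed subspaces of I(N) *)

Section Subspace.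
Context (S : set pbij).
Context (Scl : forall l,
  (forall N, exists2 f, S f & cylinder pbij_code l N f) -> S l).

Lemma nbhs_subspaceP (x : set_type S) A : nbhs x A <->
  exists N, cylinder (pbij_code \o \val) x N `<=` A.
Proof.
split=> [|[N NA]].
  rewrite nbhsE => -[_ [[V oV <-] Vx] VA].
  have /nbhs_pbijP[N NV] : nbhs (\val x) V by apply: open_nbhs_nbhs.
  by exists N => y xy; apply: VA; apply: NV.
have := @initial_continuous S pbij set_val x.
move=> /(_ _ (nbhs_pbij_cylinder (val x) N)).
by apply: (@filterS _ (nbhs x)) => y xy; apply: NA.
Qed.

Lemma subspace_coding : closed_coding (pbij_code \o \val : S -> _).
Proof.
split=> [x y xy|x|w wP].
- by apply/val_inj/pbij_ext => k; have [] := xy k.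
- apply/seteqP; split=> A; first by move=> /nbhs_subspaceP[N NA]; exists N.
  by move=> [N _ NA]; apply/nbhs_subspaceP; exists N.
- have [|l lw] := pbij_code_complete (w := w).
    by move=> N; have [x xw] := wP N; exists (val x).
  have Sl : S l.
    apply: Scl => N; have [x xw] := wP N; exists (val x); first exact: set_valP.
    by move=> k kN; rewrite lw; apply/esym/xw.
  by exists (SigSub (mem_set Sl)).
Qed.

End Subspace.

(** * The semigroup S *)

(** Makes having more than n elements visible in a finite prefix of a code. *)
Lemma not_card_le_finite (A : set nat) n : ~ (A #<= `I_n) ->
  exists X, [/\ finite_set X, X `<=` A & ~ (X #<= `I_n)].
Proof.
move=> nA; have [finA|infA] := pselect (finite_set A).
  by exists A; split=> // x.
have [X XA nX] := infinite_set_fset n.+1 infA.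
exists [set` X]; split=> // /geq_card_fset_set; rewrite set_fsetK.
by apply/negP; rewrite -ltnNge.
Qed.

Lemma finite_set_bound (A : set nat) : finite_set A ->
  exists N, forall x, A x -> (x < N)%N.
Proof.
move=> /finite_fsetP[X ->]; exists (\max_(x <- X) x).+1 => x /= xX.
by rewrite ltnS (big_fsetD1 x)//= leq_maxl.
Qed.

Lemma pbij_im_card f : pbij_im f #<= pbij_dom f.
Proof.
apply: card_le_trans (card_image_le (fun x => odflt 0 (f x)) _).
apply: subset_card_le => y [x fx]; exists x; first by exists y.
by rewrite fx.
Qed.

Lemma pbij_comp_dom f g : pbij_dom (pbij_comp f g) `<=` pbij_dom g.
Proof.
by move=> x [y] /=; case gx: (g x) => [u|//] _; exists u.
Qed.

Lemma pbij_comp_im f g : pbij_im (pbij_comp f g) `<=` pbij_im f.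
Proof.
by move=> y [x] /=; case gx: (g x) => [u|//] fu; exists u.
Qed.

Lemma pbij_comp_card f g :
  pbij_dom (pbij_comp f g) #<= pbij_dom f `&` pbij_im g.
Proof.
apply: card_le_trans (card_image_le (fun y => odflt 0 (pbij_inv g y)) _).
apply: subset_card_le => x [y] /=; case gx: (g x) => [u|//] /= fu.
exists u; first by split; [exists y|exists x].
by move/pbij_invP: gx => /= ->.
Qed.

Section BlockSemigroup.
Context (B : nat -> set nat) (n : nat).
Context (Binf : forall i, infinite_set (B i)).
Context (Bcap : forall i j, i <> j -> B i `&` B j #<= `I_n).

Definition block_set : set pbij :=
  (\bigcup_i Sym_on (B i)) `|`
  (\bigcup_i \bigcup_j \bigcup_(k in [set k | (k <= n)%N])
    I_rank k (B i) (B j)).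

Definition low_rank : set pbij := [set f | pbij_dom f #<= `I_n].

Lemma block_setP f : block_set f <->
  (exists i, Sym_on (B i) f) \/
  (low_rank f /\ exists i j, pbij_dom f `<=` B i /\ pbij_im f `<=` B j).
Proof.
split=> [[[i _ fi]|[i _ [j _ [k kn [fi fj fk]]]]]|
  [[i fi]|[fn [i [j [fi fj]]]]]].
- by left; exists i.
- right; split; last by exists i, j.
  by rewrite /low_rank/= (card_le_eql fk) card_le_II.
- by left; exists i.
- right; exists i => //; exists j => //.
  have /finite_setP[k fk] : finite_set (pbij_dom f).
    by apply: card_le_finite fn _.
  by exists k => //=; rewrite -card_le_II -(card_le_eql fk).
Qed.

Lemma block_set_sub f : block_set f ->
  exists i j, pbij_dom f `<=` B i /\ pbij_im f `<=` B j.
Proof. by move=> /block_setP[[i [-> ->]]|[_]//]; exists i, i; split=> x. Qed.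

Lemma block_set_high f : block_set f -> ~ low_rank f ->
  exists i, Sym_on (B i) f.
Proof. by move=> /block_setP[//|[]]. Qed.

Lemma low_rankI f : low_rank f -> pbij_im f #<= `I_n.
Proof. exact: card_le_trans (pbij_im_card f). Qed.

Lemma low_rank_inv f : low_rank f -> low_rank (pbij_inv f).
Proof. by rewrite /low_rank/= pbij_dom_inv; exact: low_rankI. Qed.

(** Otherwise [X] would embed in an intersection of two distinct blocks, which has at most n
    points. *)
Lemma block_unique (X : set nat) i j : ~ (X #<= `I_n) ->
  X `<=` B i -> X `<=` B j -> i = j.
Proof.
move=> nX Xi Xj; apply: contrapT => /Bcap cij; apply: nX.
by apply: card_le_trans cij; apply: subset_card_le => x Xx; split; auto.
Qed.

Lemma block_high i : ~ (B i #<= `I_n).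
Proof. by move=> Bn; apply: (@Binf i); apply/finite_set_leP; exists n. Qed.

Lemma Sym_on_inv (C : set nat) f : Sym_on C f -> Sym_on C (pbij_inv f).
Proof. by move=> [fd fi]; split; rewrite ?pbij_dom_inv ?pbij_im_inv. Qed.

Lemma Sym_on_comp (C : set nat) f g :
  Sym_on C f -> Sym_on C g -> Sym_on C (pbij_comp f g).
Proof.
have aux a b : Sym_on C a -> Sym_on C b -> pbij_dom (pbij_comp a b) = C.
  move=> [ad ai] [bd bi]; apply/seteqP; split.
    by move=> x /pbij_comp_dom; rewrite bd.
  move=> x; rewrite -bd => -[y bx]; have : C y by rewrite -bi; exists x.
  by rewrite -ad => -[z ay]; exists z; rewrite /= bx.
move=> fC gC; split; first exact: aux.
by rewrite -pbij_dom_inv pbij_inv_comp; apply: aux; exact: Sym_on_inv.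
Qed.

Lemma block_set_inv f : block_set f -> block_set (pbij_inv f).
Proof.
move=> /block_setP[[i /Sym_on_inv fi]|[fn [i [j [fi fj]]]]]; apply/block_setP.
  by left; exists i.
right; split; first exact: low_rank_inv.
by exists j, i; rewrite pbij_dom_inv pbij_im_inv.
Qed.

(** If the domain of f meets the image of g in at most n points, the composite has low rank.
    Otherwise both are permutations of blocks sharing more than n points, hence of the same
    block. *)
Lemma block_set_comp f g :
  block_set f -> block_set g -> block_set (pbij_comp f g).
Proof.
move=> fS gS; apply/block_setP.
have [fg|fg] := pselect (pbij_dom f `&` pbij_im g #<= `I_n).
  right; split; first exact: card_le_trans (pbij_comp_card f g) fg.
  have [_ [j [_ fj]]] := block_set_sub fS.
  have [i [_ [gi _]]] := block_set_sub gS.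
  exists i, j; split; first exact: subset_trans (@pbij_comp_dom f g) gi.
  exact: subset_trans (@pbij_comp_im f g) fj.
have [|i fi] := block_set_high fS.
  move=> fn; apply: fg; apply: card_le_trans fn.
  by apply: subset_card_le => x [].
have [|j gj] := block_set_high gS.
  move=> /low_rankI gn; apply: fg; apply: card_le_trans gn.
  by apply: subset_card_le => x [].
left; exists i; apply: Sym_on_comp => //; suff -> : i = j by [].
by apply: block_unique fg _ _ => x []; [rewrite fi.1|rewrite gj.2].
Qed.

Lemma cylinder_dom f g N x : cylinder pbij_code f N g -> (x < N)%N ->
  pbij_dom f x <-> pbij_dom g x.
Proof. by move=> fg /fg[fx _]; split=> -[y xy]; exists y; rewrite -xy. Qed.

Lemma cylinder_im f g N x : cylinder pbij_code f N g -> (x < N)%N ->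
  pbij_im f x <-> pbij_im g x.
Proof.
by move=> /inv_cylinder fg xN; rewrite -!pbij_dom_inv; exact: cylinder_dom xN.
Qed.

Lemma block_cylinder f i (X : set nat) : block_set f ->
  X `<=` pbij_dom f -> X `<=` B i -> ~ (X #<= `I_n) ->
  Sym_on (B i) f.
Proof.
move=> fS Xf Xi nX; have [|j fj] := block_set_high fS.
  by move=> fn; apply: nX; apply: card_le_trans (subset_card_le Xf) fn.
suff -> : i = j by [].
by apply: block_unique nX Xi _; apply: subset_trans Xf _; rewrite fj.1.
Qed.

(** For [l] of low rank, one cylinder shows its whole finite domain and image. Otherwise more than n
    points of its domain, once visible, force all closer approximants into one group [Sym_on (B i)];
    domain and image of [l] are then compared with [B i] pointwise. *)
Lemma block_set_closed l :
  (forall N, exists2 f, block_set f & cylinder pbij_code l N f) -> block_set l.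
Proof.
move=> lS; apply/block_setP; have [ln|nl] := pselect (low_rank l).
  right; split=> //.
  have [|N Nl] := @finite_set_bound (pbij_dom l `|` pbij_im l).
    rewrite finite_setU; split; apply: card_le_finite (finite_II n) => //.
    exact: low_rankI.
  have [f /block_set_sub[i [j [fi fj]]] lf] := lS N.
  exists i, j; split=> x lx.
    by apply/fi/(cylinder_dom lf) => //; apply: Nl; left.
  by apply/fj/(cylinder_im lf) => //; apply: Nl; right.
have [X [finX Xl nX]] := not_card_le_finite nl.
have [N NX] := finite_set_bound finX.
have Xf f M : cylinder pbij_code l M f -> (N <= M)%N ->
    X `<=` pbij_dom f.
  move=> lf NM x Xx; apply/(cylinder_dom lf); last exact: Xl.
  by apply: leq_trans NM; apply: NX.
have [f0 f0S lf0] := lS N.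
have [|i f0i] := block_set_high f0S.
  move=> fn; apply: nX; apply: card_le_trans fn.
  by apply: subset_card_le; apply: Xf lf0 _.
have Xi : X `<=` B i by rewrite -f0i.1; apply: Xf lf0 _.
left; exists i.
have lsym x : exists2 f, Sym_on (B i) f & cylinder pbij_code l x.+1 f.
  have [f fS lf] := lS (maxn N x.+1); exists f.
    by apply: block_cylinder Xi nX => //; apply: Xf lf _; rewrite leq_maxl.
  by apply: cylinder_le lf; rewrite leq_maxr.
split; apply/seteqP; split=> x; have [f [fd fi] lf] := lsym x.
- by move/(cylinder_dom lf (leqnn _)); rewrite fd.
- by move=> Bx; apply/(cylinder_dom lf (leqnn _)); rewrite fd.
- by move/(cylinder_im lf (leqnn _)); rewrite fi.
- by move=> Bx; apply/(cylinder_im lf (leqnn _)); rewrite fi.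
Qed.

Lemma Sym_on_cylinder f i : Sym_on (B i) f ->
  exists N, forall g, block_set g -> cylinder pbij_code f N g -> Sym_on (B i) g.
Proof.
move=> fi; have [X [finX Xi nX]] := not_card_le_finite (@block_high i).
have [N NX] := finite_set_bound finX.
exists N => g gS fg; apply: (block_cylinder _ _ Xi nX) => //.
by move=> x Xx; apply/(cylinder_dom fg); [exact: NX|rewrite fi.1; exact: Xi].
Qed.

End BlockSemigroup.

(** * Isolated and non-isolated elements of low rank *)

Lemma card_sub_eq (A C : set nat) n :
  A `<=` C -> A #= `I_n -> C #<= `I_n -> A = C.
Proof.
move=> AC An Cn.
have finA : finite_set A by exists n.
have finC : finite_set C by apply: card_le_finite Cn _.
rewrite -(fset_setK finA) -(fset_setK finC).
suff -> : fset_set A = fset_set C by []; apply/eqP.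
rewrite eqEfcard (card_fset_set An) geq_card_fset_set// andbT.
by rewrite -fset_set_sub.
Qed.

Lemma pbij_addpt_inj (f : pbij) x y u v w : pbij_inv f y = None ->
  (if u == x then Some y else f u) = Some w ->
  (if v == x then Some y else f v) = Some w -> u = v.
Proof.
move=> fy; case: eqP => [->|_]; case: eqP => [->|_] //.
- by move=> [<-] /pbij_invP; rewrite fy.
- by move=> + [yw]; rewrite -yw => /pbij_invP; rewrite fy.
- exact: pbij_inj.
Qed.

Definition pbij_addpt (f : pbij) x y (fy : pbij_inv f y = None) : pbij :=
  PBij (fun u v w => @pbij_addpt_inj f x y u v w fy).

Lemma pbij_addptP (f : pbij) x y (fy : pbij_inv f y = None) u v :
  f x = None ->
  pbij_addpt x fy u = Some v <-> (u = x /\ v = y) \/ f u = Some v.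
Proof.
move=> fx /=; case: eqP => [->|ux]; last by split=> [|[[]|]//]; right.
by rewrite fx; split=> [[]|[[_ ->]|]//]; left.
Qed.

Lemma pbij_addpt_cylinder (f : pbij) x y (fy : pbij_inv f y = None) N :
  f x = None -> (N <= x)%N -> (N <= y)%N ->
  cylinder pbij_code f N (pbij_addpt x fy).
Proof.
move=> fx Nx Ny k kN; congr (_, _); apply: option_eqP => z.
  split=> [fk|/(pbij_addptP fy _ _ fx)[[kx]|//]].
    by apply/(pbij_addptP fy _ _ fx); right.
  by move: kN; rewrite kx ltnNge Nx.
split=> [/pbij_invP fz|/pbij_invP/(pbij_addptP fy _ _ fx)[[_ ky]|fz]].
- by apply/pbij_invP/(pbij_addptP fy _ _ fx); right.
- by move: kN; rewrite ky ltnNge Ny.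
- exact/pbij_invP.
Qed.

Lemma pbij_id_inj (C : set nat) x y z :
  (if x \in C then Some x else None) = Some z ->
  (if y \in C then Some y else None) = Some z -> x = y.
Proof. by case: ifP => // _ [->]; case: ifP => // _ [->]. Qed.

Definition pbij_id (C : set nat) : pbij := PBij (@pbij_id_inj C).

Lemma pbij_idP C x y : pbij_id C x = Some y <-> C x /\ x = y.
Proof.
rewrite /=; case: ifPn => [/set_mem Cx|/negP nCx]; first by split=> [[]|[_ ->]].
by split=> // -[/mem_set].
Qed.

Lemma Sym_on_id C : Sym_on C (pbij_id C).
Proof.
split; apply/seteqP; split=> x.
- by move=> [y /pbij_idP[]].
- by move=> Cx; exists x; apply/pbij_idP.
- by move=> [y /pbij_idP[Cy <-]].
- by move=> Cx; exists x; apply/pbij_idP.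
Qed.

Lemma infinite_set_ge (A : set nat) N : infinite_set A ->
  exists2 x, A x & (N <= x)%N.
Proof.
move=> infA; apply: contrapT => AN; apply: infA.
apply: (@sub_finite_set _ _ `I_N) => // x Ax /=.
by rewrite ltnNge; apply/negP => Nx; apply: AN; exists x.
Qed.

Lemma pbij_none_dom (f : pbij) x : ~ pbij_dom f x -> f x = None.
Proof. by case fx: (f x) => [y|//] []; exists y. Qed.

Section BlockTopology.
Context (B : nat -> set nat) (n : nat).
Context (Binf : forall i, infinite_set (B i)).
Context (Bcap : forall i j, i <> j -> B i `&` B j #<= `I_n).
Context (Bfin : (0 < n)%N -> forall F : set nat, F #= `I_n ->
  finite_set [set i | F `<=` B i]).

(** A nearby element has a domain containing that of f. If its rank is low, counting makes the
    domains equal; if not, its domain is one of the finitely many blocks containing the domain of f,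
    and each of these is excluded by a test point. *)
Lemma rank_isolated f : block_set B n f -> (0 < n)%N -> pbij_dom f #= `I_n ->
  exists N, forall g, block_set B n g -> cylinder pbij_code f N g -> g = f.
Proof.
move=> fS n0 fn; have finI := Bfin n0 fn.
have findom : finite_set (pbij_dom f) by exists n.
have /choice[h hP] i : exists x, (B i `\` pbij_dom f) x.
  exact/infinite_setN0/infinite_setD.
(* [N] exceeds the domain of f and the test points [h i], outside that domain, of the blocks
   containing it. *)
have [|N NP] := @finite_set_bound
    (pbij_dom f `|` h @` [set i | pbij_dom f `<=` B i]).
  by rewrite finite_setU; split=> //; apply: finite_image.
exists N => g gS fg.
have dfg : pbij_dom f `<=` pbij_dom g.
  by move=> x fx; apply/(cylinder_dom fg) => //; apply: NP; left.
have [gn|ng] := pselect (low_rank n g).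
  have dfgE := card_sub_eq dfg fn gn.
  apply: pbij_ext => x; have [fx|nfx] := pselect (pbij_dom f x).
    have xN : (x < N)%N by apply: NP; left.
    by have [-> _] := fg x xN.
  by rewrite !pbij_none_dom// -dfgE.
have [i gi] := block_set_high gS ng.
have [Bhi nfhi] := hP i; exfalso; apply: nfhi; apply/(cylinder_dom fg).
  by apply: NP; right; exists i => //=; rewrite -gi.1.
by rewrite gi.1.
Qed.

(** For n = 0 the blocks are disjoint; if all met [0, N), choosing a point of each would inject the
    naturals into a finite set. *)
Lemma avoid_block N : n = 0%N -> exists i, forall x, (x < N)%N -> ~ B i x.
Proof.
move=> n0; apply: contrapT => noi.
have /choice[h hP] i : exists x, (x < N)%N /\ B i x.
  apply: contrapT => nx; apply: noi; exists i => x xN Bx.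
  by apply: nx; exists x.
have hinj i j : h i = h j -> i = j.
  move=> hij; apply: contrapT => /Bcap; rewrite n0 II0 card_le0 => /eqP BB.
  suff : set0 (h i) by []; rewrite -BB; split; first exact: (hP i).2.
  by rewrite hij; exact: (hP j).2.
apply: infinite_nat; apply: (@sub_finite_set _ _ (h @^-1` `I_N)).
  by move=> i _; exact: (hP i).1.
by apply: finite_preimage => // i j _ _; exact: hinj.
Qed.

Lemma low_rank_not_isolated f N : block_set B n f -> low_rank n f ->
  ~ ((0 < n)%N /\ pbij_dom f #= `I_n) ->
  exists g, [/\ block_set B n g, cylinder pbij_code f N g & g <> f].
Proof.
move=> fS fn nfn; have [fnE|fnN] := pselect (pbij_dom f #= `I_n).
  (* Rank n is left only for n = 0; then f is empty and is approximated by the identity of a block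
     that avoids [0, N). *)
  have n0 : n = 0%N.
    by apply/eqP; rewrite -leqn0 leqNgt; apply/negP => n0; apply: nfn.
  have f0 x : f x = None.
    apply: pbij_none_dom; move: fnE; rewrite n0 II0 card_eq0 => /eqP ->.
    exact.
  have f0' y : pbij_inv f y = None.
    by case E: (pbij_inv f y) => [x|//]; move/pbij_invP: E; rewrite f0.
  have [i iN] := avoid_block N n0.
  have [x [Bx _]] : (B i `&` setT) !=set0.
    by rewrite setIT; apply: infinite_setN0.
  exists (pbij_id (B i)); split.
  - by left; exists i => //; apply: Sym_on_id.
  - move=> k kN; congr (_, _); apply: option_eqP => z.
      by rewrite f0; split=> // /pbij_idP[/iN].
    by rewrite f0'; split=> // /pbij_invP/pbij_idP[+ zk]; rewrite zk => /iN.
  - move=> /(congr1 (fun h : pbij => h x)); rewrite f0.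
    by have /pbij_idP -> : B i x /\ x = x by [].
have findom : finite_set (pbij_dom f) by apply: card_le_finite fn _.
have finim : finite_set (pbij_im f) by apply: card_le_finite (low_rankI fn) _.
have [i [j [fi fj]]] := block_set_sub fS.
(* Rank below n leaves room for one more pair; taken from [B i] and [B j] beyond [N], it does not
   show in the cylinder. *)
have [x [Bx nfx] Nx] := infinite_set_ge N (infinite_setD (@Binf i) findom).
have [y [By nfy] Ny] := infinite_set_ge N (infinite_setD (@Binf j) finim).
have fx := pbij_none_dom nfx.
have fy : pbij_inv f y = None by apply: pbij_none_dom; rewrite pbij_dom_inv.
exists (pbij_addpt x fy); split.
- apply/block_setP; right; split; last first.
    exists i, j; split=> z [w].
      by move=> /(pbij_addptP fy _ _ fx)[[-> _]//|fz]; apply: fi; exists w.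
    by move=> /(pbij_addptP fy _ _ fx)[[_ ->]//|fw]; apply: fj; exists w.
  have [k fk] := findom.
  have kn : (k < n)%N.
    rewrite ltn_neqAle; apply/andP; split.
      by apply/eqP => kn; apply: fnN; rewrite -kn.
    by rewrite -card_le_II -(card_le_eql fk).
  have sub : pbij_dom (pbij_addpt x fy) `<=` x |` pbij_dom f.
    by move=> z [w /(pbij_addptP fy _ _ fx)[[-> _]|fz]]; [left|right; exists w].
  apply: card_le_trans (subset_card_le sub) _.
  have /finite_setP[m mE] : finite_set (x |` pbij_dom f) by rewrite finite_setU.
  rewrite (card_le_eql mE) card_le_II -(card_fset_set mE) fset_setU1//.
  by rewrite cardfsU1 (card_fset_set fk); case: (_ \notin _) => //; exact: ltnW.
- exact: pbij_addpt_cylinder.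
- move=> /(congr1 (fun h : pbij => h x)); rewrite fx.
  suff -> : pbij_addpt x fy x = Some y by [].
  by apply/(pbij_addptP fy _ _ fx); left.
Qed.

End BlockTopology.

(** * Polishness and the Pettis property *)

Lemma pbij_comp_invl f : pbij_comp (pbij_inv f) f = pbij_id (pbij_dom f).
Proof.
apply: pbij_ext => x; apply: option_eqP => y; split=> [|/pbij_idP[[z fx] <-]].
  rewrite /=; case fx: (f x) => [z|//] /= /pbij_invP fy.
  by apply/pbij_idP; split; [exists z|exact: pbij_inj fx fy].
by rewrite /= fx /=; apply/pbij_invP.
Qed.

Lemma pbij_comp_invr f : pbij_comp f (pbij_inv f) = pbij_id (pbij_im f).
Proof. by rewrite -{1}(pbij_invK f) pbij_comp_invl pbij_dom_inv. Qed.

Lemma pbij_comp_id f C : pbij_dom f `<=` C -> pbij_comp f (pbij_id C) = f.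
Proof.
move=> fC; apply: pbij_ext => x /=; case: ifPn => // /negP nCx.
by rewrite pbij_none_dom// => /fC/mem_set.
Qed.

Lemma pbij_comp_idl f C : pbij_im f `<=` C -> pbij_comp (pbij_id C) f = f.
Proof.
move=> fC; apply: pbij_ext => x /=; case fx: (f x) => [y|//] /=.
by rewrite mem_set//; apply: fC; exists x.
Qed.

(** [F] has at most one point, and that point is not isolated; removing it from a nonempty open set
    leaves a nonempty open set. *)
Lemma coding_nowhere_dense (T : topologicalType) (K : countType)
    (c : T -> nat -> K) (F : set T) : closed_coding c ->
  (forall x y, F x -> F y -> x = y) ->
  (forall x N, F x -> exists2 y, cylinder c x N y & y <> x) ->
  nowhere_dense F.
Proof.
move=> cP F1 Facc; apply/nowhere_denseP => O oO O0.
have [[x [Ox Fx]]|OF] := pselect (O `&` F !=set0); last first.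
  by exists O; split=> //; rewrite -subset0 => x OFx; apply: OF; exists x.
exists (O `&` ~` [set x]); split.
- apply: openI => //; apply/(open_codingP cP) => y yx.
  have [k yxk] : exists k, c y k <> c x k.
    apply: contrapT => /forallNP yxk; apply: yx; have [cinj _ _] := cP.
    by apply: cinj => k; apply: contrapT => /yxk.
  by exists k.+1 => z yz zx; apply: yxk; rewrite yz// zx.
- have /(open_codingP cP)/(_ _ Ox)[N NO] := oO.
  by have [y xy yx] := Facc x N Fx; exists y; split=> //; apply: NO.
- by move=> y [].
- by rewrite -subset0 => y [[_ yx] Fy]; apply: yx; apply: F1.
Qed.

Section BlockPettis.
Context (B : nat -> set nat) (n : nat).
Context (Binf : forall i, infinite_set (B i)).
Context (Bcap : forall i j, i <> j -> B i `&` B j #<= `I_n).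
Context (Bfin : (0 < n)%N -> forall F : set nat, F #= `I_n ->
  finite_set [set i | F `<=` B i]).

Local Notation S := (block_set B n).
Local Notation code := (pbij_code \o \val : S -> _).

Definition block_mul (a b : S) : S :=
  SigSub (mem_set (block_set_comp Bcap (set_valP a) (set_valP b))).

Definition block_inv (a : S) : S :=
  SigSub (mem_set (block_set_inv (set_valP a))).

Lemma block_coding : closed_coding code.
Proof. by apply: subspace_coding => l; apply: block_set_closed. Qed.

(** Joint continuity and continuity of both translations are read off from this form. *)
Lemma block_mul_near a b A : nbhs (block_mul a b) A ->
  exists M, forall a' b',
    cylinder code a M a' -> cylinder code b M b' -> A (block_mul a' b').
Proof.
move=> /(nbhs_codingP block_coding)[N NA].
have [M MP] := comp_cylinder (val a) (val b) N.
by exists M => a' b' aa' bb'; apply: NA; apply: MP.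
Qed.

Lemma block_mul_continuous : continuous (fun p : S * S => block_mul p.1 p.2).
Proof.
move=> [a b] A /block_mul_near[M MA].
exists (cylinder code a M, cylinder code b M).
  by split; apply: (nbhs_cylinder block_coding).
by move=> [a' b'] [aa' bb']; apply: MA.
Qed.

Lemma block_mul_continuousl a : continuous (block_mul a).
Proof.
move=> b A /block_mul_near[M MA]; apply/(nbhs_codingP block_coding).
by exists M => b' bb'; apply: MA.
Qed.

Lemma block_mul_continuousr b : continuous (block_mul^~ b).
Proof.
move=> a A /block_mul_near[M MA]; apply/(nbhs_codingP block_coding).
by exists M => a' aa'; apply: MA.
Qed.

Lemma block_inv_continuous : continuous block_inv.
Proof.
move=> a A /(nbhs_codingP block_coding)[N NA].
apply/(nbhs_codingP block_coding); exists N => b ab.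
by apply: NA; apply: inv_cylinder ab.
Qed.

Lemma block_inverse_semigroup : inverse_semigroup block_mul block_inv.
Proof.
split=> [a b d|a b]; first by apply: val_inj; apply: pbij_compA.
have /= ab := pbij_inverseP (val a) (val b); split.
  move=> [/(congr1 val)/= aba /(congr1 val)/= bab].
  by apply: val_inj; apply/ab.
move=> ba; have /ab[aba bab] : val b = pbij_inv (val a) by rewrite ba.
by split; apply: val_inj.
Qed.

Definition block_group i : set S := [set x | Sym_on (B i) (val x)].

Lemma open_block_group i : open (block_group i).
Proof.
apply/(open_codingP block_coding) => x /(Sym_on_cylinder Binf Bcap)[N NP].
by exists N => y xy; apply: NP xy; exact: set_valP.
Qed.

Lemma meager_low_rank : meager
  [set x : S | low_rank n (val x) /\ ~ ((0 < n)%N /\ pbij_dom (val x) #= `I_n)].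
Proof.
set L := [set x | _].
(* An element of finite domain is determined by a finite list of values, continued by [None]; [F k]
   has at most one element because [pickle] is injective. *)
pose F k : set S := [set x | L x /\ exists2 s : seq (option nat),
  pickle s = k & forall z, val x z = nth None s z].
apply: (@meager_sub _ _ (\bigcup_k F k)).
  move=> x Lx; have [|N NP] := @finite_set_bound (pbij_dom (val x)).
    by apply: card_le_finite Lx.1 _.
  exists (pickle (mkseq (val x) N)) => //; split=> //; eexists => // z.
  have [zN|Nz] := ltnP z N; first by rewrite nth_mkseq.
  rewrite nth_default ?size_mkseq// pbij_none_dom// => /NP.
  by rewrite ltnNge Nz.
apply: meager_bigcup => k; apply: nowhere_dense_meager.
apply: (coding_nowhere_dense block_coding) => [x y|x N [[xn nxn] _]].
  move=> [_ [s <- xs]] [_ [t /(pcan_inj pickleK) -> ys]].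
  by apply/val_inj/pbij_ext => z; rewrite xs ys.
have [g [gS xg gx]] := low_rank_not_isolated Binf Bcap N (set_valP x) xn nxn.
by exists (SigSub (mem_set gS)) => // /(congr1 val).
Qed.

(** In S the product of the inverse of a with a is only the identity on the domain of a; it cancels
    here because b has its image in the same block. *)
Lemma block_mulVK i a b :
  block_group i a -> block_group i b ->
  block_mul (block_inv a) (block_mul a b) = b.
Proof.
move=> [ad ai] [bd bi]; apply: val_inj => /=.
by rewrite pbij_compA pbij_comp_invl ad pbij_comp_idl// bi.
Qed.

Lemma block_mulK i a b : block_group i a -> block_group i b ->
  block_mul (block_mul a b) (block_inv b) = a.
Proof.
move=> [ad ai] [bd bi]; apply: val_inj => /=.
by rewrite -pbij_compA pbij_comp_invr bi pbij_comp_id// ad.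
Qed.

Lemma block_invK a : block_inv (block_inv a) = a.
Proof. by apply: val_inj; apply: pbij_invK. Qed.

Lemma block_group_mul i a b :
  block_group i a -> block_group i b -> block_group i (block_mul a b).
Proof. exact: Sym_on_comp. Qed.

Lemma block_group_inv i a : block_group i a -> block_group i (block_inv a).
Proof. exact: Sym_on_inv. Qed.

(** The idempotent e is the identity on the domain of a, so it too has rank n and is isolated; its
    singleton is the required open set. *)
Lemma Pettis_isolated (A : set S) a :
  (0 < n)%N -> A a -> pbij_dom (val a) #= `I_n ->
  exists (e : S) (V : set S),
    [/\ block_mul e e = e, open V, V e &
        V `<=` [set c | exists a b,
          [/\ A a, A b & c = block_mul (block_inv a) b]]].
Proof.
move=> n0 Aa an; pose e := block_mul (block_inv a) a.
have eE : val e = pbij_id (pbij_dom (val a)) := pbij_comp_invl _.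
have [ed _] := Sym_on_id (pbij_dom (val a)).
exists e, [set e]; split=> //.
- apply: val_inj; rewrite -[LHS]/(pbij_comp (val e) (val e)) eE.
  by rewrite pbij_comp_id// ed.
- apply/(open_codingP block_coding) => _ ->.
  have [|N NP] := rank_isolated Binf Bfin (set_valP e) n0.
    by rewrite eE ed.
  by exists N => y /NP ye; apply: val_inj; apply: ye; exact: set_valP.
- by move=> _ ->; exists a, a.
Qed.

(* The classical argument for Polish groups: if [V] is the open set almost
   equal to [A] and [g] lies in [V], then for [h] near the identity [V]
   and [V h^-1] share a nonempty open set, so [a] and [a h] both lie in [A]
   for some [a]. *)
Lemma Pettis_block (A V : set S) i :
  open V -> meager (A `+` V) -> ~ meager (A `&` block_group i) ->
  exists (e : S) (V : set S),
    [/\ block_mul e e = e, open V, V e &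
        V `<=` [set c | exists a b,
          [/\ A a, A b & c = block_mul (block_inv a) b]]].
Proof.
move=> oV mAV nmA.
(* If [V] missed the group, the part of [A] in the group would lie in the meager set [A] + [V]. *)
have [g [Vg Gg]] : V `&` block_group i !=set0.
  apply: contrapT => VG; apply: nmA; apply: meager_sub mAV.
  by move=> x [Ax Gx]; left; split=> // Vx; apply: VG; exists x.
have oI (f : S -> S) U : continuous f -> open U -> open (f @^-1` U).
  by move=> /continuousP; apply.
pose e := block_mul (block_inv g) g.
have Ge : block_group i e.
  by apply: block_group_mul => //; apply: block_group_inv.
have geE : block_mul g e = g.
  apply: val_inj => /=; have [gd _] := Gg.
  by rewrite pbij_comp_invl pbij_comp_id.
exists e, (block_group i `&` block_mul g @^-1` V); split.
- apply: val_inj => /=; rewrite pbij_comp_invl pbij_comp_id//.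
  by have [-> _] := Sym_on_id (pbij_dom (val g)).
- apply: openI (open_block_group i) _; apply: oI => //.
  exact: block_mul_continuousl.
- by split=> //; rewrite /preimage/= geE.
move=> h [Gh Vgh].
pose U := (V `&` block_group i) `&` block_mul^~ h @^-1` V.
have oU : open U.
  apply: openI; first by apply: openI oV (open_block_group i).
  by apply: oI => //; exact: block_mul_continuousr.
have Uh : U !=set0 by exists g.
(* Right translation by h is a homeomorphism of the group, so the points a for which a h falls into
   [A] + [V] form a meager set as well. *)
have mAVh : meager (block_group i `&` block_mul^~ h @^-1` (A `+` V)).
  apply: (@meager_preimage _ _ _ (block_mul^~ (block_inv h))) => //.
  - exact: open_block_group.
  - exact: block_mul_continuousr.
  - exact: block_mul_continuousr.
  - by move=> x Gx; split; [exact: block_group_mul|exact: block_mulK Gx Gh].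
  - move=> x Gx; have Gh' := block_group_inv Gh; split.
      exact: block_group_mul.
    by have := block_mulK Gx Gh'; rewrite block_invK.
have [a [[Va Ga] Vah] nAV] :=
  coding_Baire block_coding oU Uh (meagerU mAV mAVh).
exists a, (block_mul a h); split.
- by apply: contrapT => nAa; apply: nAV; left; right.
- by apply: contrapT => nAah; apply: nAV; right; split=> //; right.
- by rewrite (block_mulVK Ga Gh).
Qed.

Lemma block_Pettis : Pettis_property block_mul block_inv.
Proof.
move=> A nmA [V [oV mAV]].
have [[n0 [a Aa an]]|noiso] := pselect
    ((0 < n)%N /\ exists2 a, A a & pbij_dom (val a) #= `I_n).
  exact: Pettis_isolated Aa an.
have [i nmAi] : exists i, ~ meager (A `&` block_group i).
  (* As [A] has no isolated element of rank n, its low-rank part is meager, and the rest lies in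
     countably many groups. *)
  apply: contrapT => /forallNP mA; apply: nmA.
  have mA' i : meager (A `&` block_group i) by apply: contrapT; apply: mA.
  apply: meager_sub (meagerU meager_low_rank (meager_bigcup mA')) => x Ax.
  have [xn|nx] := pselect (low_rank n (val x)).
    by left; split=> // -[n0 xn']; apply: noiso; split=> //; exists x.
  have [i xi] := block_set_high (set_valP x) nx.
  by right; exists i.
exact: Pettis_block oV mAV nmAi.
Qed.

End BlockPettis.

Theorem theorem4p5 (R : realType) (B : nat -> set nat) (n : nat)
  (Binf : forall i, infinite_set (B i))
  (Bcap : forall i j, i <> j -> ((B i `&` B j) #<= `I_n)%card)
  (Bfin : (0 < n)%N -> forall F : set nat, (F #= `I_n)%card ->
     finite_set [set i | F `<=` B i]) :
  let S : set pbij :=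
    (\bigcup_i Sym_on (B i)) `|`
    (\bigcup_i \bigcup_j \bigcup_(k in [set k | (k <= n)%N])
       I_rank k (B i) (B j)) in
  exists (mul : set_type S -> set_type S -> set_type S)
         (inv : set_type S -> set_type S),
    [/\ forall a b, set_val (mul a b) = pbij_comp (set_val a) (set_val b),
        Polish_inverse_semigroup R mul inv &
        Pettis_property mul inv].
Proof.
exists (block_mul Bcap), (@block_inv B n); split=> //.
  split; first split.
  - exact: block_inverse_semigroup.
  - exact: block_mul_continuous.
  - exact: block_inv_continuous.
  - apply: coding_Polish (block_coding Bcap) _ _.
    (* The identity of [B 0] serves as the base point for the countable dense set. *)
    exists (pbij_id (B 0%N)); apply/mem_set; left; exists 0%N => //.
    exact: Sym_on_id.
exact: block_Pettis.
Qed.
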